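(* Let $X_1,\ldots,X_n$ be Bernoulli $0/1$ random variables. Let $\beta\in(0,1)$ be such that $\beta n$ is a positive integer and let $k$ be any positive integer such that $0<k<\beta n$. Then $$\frac{1}{\binom{n}{\beta n}}\sum_{A:\,|A|=\beta n}\mathbb{E}\left[\prod_{i\in A}X_i\right]\le \mathbb{P}\left[\sum_{i=1}^nX_i\ge\beta n\right]\le\frac{1}{\binom{\beta n}{k}}\sum_{A:\,|A|=k}\mathbb{E}\left[\prod_{i\in A}X_i\right],$$ where the sums run over subsets $A\subseteq\{1,\ldots,n\}$ of the indicated cardinality.
   Context: The random variables are $\{0,1\}$-valued, defined on a common probability space, and may be dependent and have different means. *)

(* Defs.v *)
From mathcomp Require Import all_boot all_order all_algebra.
From mathcomp Require Import all_classical all_reals all_analysis.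

(* Main.v *)
Require Import Defs.
From mathcomp Require Import all_boot all_order all_algebra.
From mathcomp Require Import all_classical all_reals all_analysis.
From mathcomp Require Import measurable_realfun.
Set Implicit Arguments.
Unset Strict Implicit.
Unset Printing Implicit Defensive.
Import Order.TTheory GRing.Theory Num.Theory.
Local Open Scope classical_set_scope.
Local Open Scope ring_scope.

(** Both bounds come from integrating pointwise inequalities.  Fix an outcome
    and let [s] be the number of indices [i] with [X i = 1].  A product of the
    [X i] over a set [A] is 1 when [A] lies inside the set of successes and 0
    otherwise, so the sum of these products over all [A] of cardinality [j]
    counts the [j]-subsets of the successes: it equals ['C(s, j)]
    ([sum_prod_01]).  Hence everything reduces to comparing binomial
    coefficients with the indicator of [m <= s], where [m] is [beta * n]:
    - ['C(s, m)] vanishes when [s < m] and is at most ['C(n, m)] because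
      [s <= n], so ['C(s, m) / 'C(n, m)] is at most the indicator
      ([bin_ratio_le_indicator]);
    - ['C(s, k) >= 'C(m, k)] when [m <= s], so ['C(s, k) / 'C(m, k)] is at
      least the indicator ([indicator_le_bin_ratio]).

    Taking expectations, the indicator becomes the probability of the event,
    and linearity turns the expected count into the normalised sum of the
    expectations of the products ([expectation_scaled_sum]).  Linearity and
    monotonicity of expectation hold under any joint law of the [X i]. *)

Lemma sum_01 (R : nzSemiRingType) (I : finType) (y : I -> R)
    (y01 : forall i, y i = 0 \/ y i = 1) :
  \sum_i y i = #|[set i | y i == 1]%SET|%:R.
Proof.
rewrite -sum1_card natr_sum [RHS]big_mkcond /=; apply: eq_bigr => i _.
rewrite inE; case: (y01 i) => ->; last by rewrite eqxx.
by rewrite eq_sym oner_eq0.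
Qed.

Lemma prod_01 (R : comNzSemiRingType) (I : finType) (y : I -> R)
    (y01 : forall i, y i = 0 \/ y i = 1) (A : {set I}) :
  \prod_(i in A) y i = (A \subset [set i | y i == 1]%SET)%:R.
Proof.
have [AS|/subsetPn[i iA]] := boolP (A \subset _).
  by rewrite big1// => i /(fintype.subsetP AS); rewrite inE => /eqP.
rewrite inE => yi; rewrite (bigD1 i)//=.
by case: (y01 i) yi => ->; rewrite ?eqxx// mul0r.
Qed.

(** Only the subsets of the set of successes contribute, each of them 1. *)
Lemma sum_prod_01 (R : comNzSemiRingType) (I : finType) (y : I -> R)
    (y01 : forall i, y i = 0 \/ y i = 1) (j : nat) :
  \sum_(A : {set I} | #|A| == j) \prod_(i in A) y i =
  'C(#|[set i | y i == 1]%SET|, j)%:R.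
Proof.
rewrite -cards_draws -sum1_card natr_sum.
rewrite (eq_bigr _ (fun A _ => prod_01 y01 A)) big_mkcond [RHS]big_mkcond /=; apply: eq_bigr => A _.
by rewrite inE; case: (A \subset _); case: (#|A| == j).
Qed.

Lemma bin_ratio_le_indicator (R : numFieldType) (n m s : nat) :
  (s <= n)%N -> 'C(n, m)%:R^-1 * 'C(s, m)%:R <= (m <= s)%N%:R :> R.
Proof.
move=> sn; have [ms|sm] := leqP m s; last by rewrite (bin_small sm) mulr0.
by rewrite mulrC ler_pdivrMr ?mul1r ?ler_nat ?leq_bin2l// ltr0n bin_gt0
  (leq_trans ms).
Qed.

Lemma indicator_le_bin_ratio (R : numFieldType) (m k s : nat) :
  (k <= m)%N -> (m <= s)%N%:R <= 'C(m, k)%:R^-1 * 'C(s, k)%:R :> R.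
Proof.
move=> km; have [ms|_] := leqP m s; last first.
  by rewrite mulr_ge0 ?invr_ge0 ?ler0n.
by rewrite mulrC ler_pdivlMr ?mul1r ?ler_nat ?leq_bin2l// ltr0n bin_gt0.
Qed.

(** Nonnegativity makes this an instance of additivity of the integral, with
    both sides possibly infinite. *)
Lemma expectation_scaled_sum (R : realType) (d : measure_display)
    (T : measurableType d) (P : probability T R) (I : finType) (Q : pred I)
    (Y : I -> T -> R) (c : R) (c0 : 0 <= c)
    (mY : forall i, measurable_fun setT (Y i)) (Y0 : forall i x, 0 <= Y i x) :
  (c%:E * \sum_(i | Q i) 'E_P[Y i] =
   'E_P[(fun x => (c * \sum_(i | Q i) Y i x)%R)])%E.
Proof.
rewrite expectation.unlock.
under [RHS]eq_integral do rewrite EFinM -sumEFin -big_filter.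
rewrite ge0_integralZl_EFin//; first last.
- by apply: emeasurable_sum => i; exact/measurable_EFinP.
- by move=> x _; apply: sume_ge0 => i _; rewrite lee_fin.
rewrite ge0_integral_sum// ?big_filter//.
- by move=> i; exact/measurable_EFinP.
- by move=> i x _; rewrite lee_fin.
Qed.

Theorem theorem1p7 (R : realType) (d : measure_display) (T : measurableType d)
    (P : probability T R) (n : nat) (X : 'I_n -> {RV P >-> R})
    (X01 : forall (i : 'I_n) (x : T), X i x = 0 \/ X i x = 1)
    (beta : R) (beta01 : 0 < beta < 1)
    (m : nat) (m_gt0 : (0 < m)%N) (betan : beta * n%:R = m%:R)
    (k : nat) (k_gt0 : (0 < k)%N) (k_lt : k%:R < beta * n%:R) :
  ((('C(n, m)%:R)^-1)%:E *
     \sum_(A : {set 'I_n} | #|A| == m) 'E_P[(fun x => (\prod_(i in A) X i x)%R)]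
   <= P [set x | (beta * n%:R <= \sum_(i < n) X i x)%R])%E
  /\
  (P [set x | (beta * n%:R <= \sum_(i < n) X i x)%R]
   <= (('C(m, k)%:R)^-1)%:E *
     \sum_(A : {set 'I_n} | #|A| == k) 'E_P[(fun x => (\prod_(i in A) X i x)%R)])%E.
Proof.
rewrite betan in k_lt *; rewrite ltr_nat in k_lt.
set E := [set x | _].
pose s x := #|[set i | X i x == 1]%SET|.
have mX i : measurable_fun setT (X i) by [].
have mprod (A : {set 'I_n}) :
    measurable_fun setT (fun x => \prod_(i in A) X i x).
  by under eq_fun do rewrite -big_filter; exact: measurable_prod.
have prod0 (A : {set 'I_n}) x : 0 <= \prod_(i in A) X i x.
  by rewrite prod_01// ler0n.
have mcount (c : R) j : measurable_fun setT
    (fun x => c * \sum_(A : {set 'I_n} | #|A| == j) \prod_(i in A) X i x).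
  apply: measurable_funM => //.
  by under eq_fun do rewrite -big_filter; exact: measurable_sum.
have count0 (c : R) j x : 0 <= c ->
    0 <= c * \sum_(A : {set 'I_n} | #|A| == j) \prod_(i in A) X i x.
  by move=> c0; rewrite mulr_ge0// sumr_ge0.
have mE : measurable E.
  rewrite -[E]setTI; apply: measurable_fun_le => //.
  exact: measurable_sum.
have indicE x : \1_E x = (m <= s x)%N%:R :> R.
  rewrite indicE; congr (_%:R); congr nat_of_bool.
  by apply/idP/idP; rewrite inE /E /= sum_01// ler_nat.
rewrite -expectation_indic// !expectation_scaled_sum ?invr_ge0 ?ler0n//.
split; apply: expectation_le => //;
  try by move=> x; rewrite ?count0 ?invr_ge0 ?indicE ?ler0n.
- apply/aeW => x; rewrite indicE sum_prod_01//.
  by apply: bin_ratio_le_indicator; rewrite -[leqRHS]card_ord max_card.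
- apply/aeW => x; rewrite indicE sum_prod_01//.
  exact/indicator_le_bin_ratio/ltnW.
Qed.
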